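(* Let $(A,B,E,\mathrm{tr}_B)$ be a left Gabor bimodule, and let $g\in E$. Then there exists $h\in E$ such that ${}_\bullet\langle f,g\rangle h=f$ for all $f\in E$ if and only if there exist constants $C,D>0$ such that $$C\,(f,f)_E\le (f\langle g,g\rangle_\bullet,f)_E\le D\,(f,f)_E\qquad\text{for all } f\in H_E .$$ In other words, $g$ generates a module frame for $E$ if and only if these inequalities are satisfied for some $C,D>0$.
   Context: An $A$-$B$-equivalence bimodule is an $A$-$B$-bimodule $E$ that is a left Hilbert $A$-module with inner product ${}_\bullet\langle\cdot,\cdot\rangle$ (linear in the first variable) and a right Hilbert $B$-module with inner product $\langle\cdot,\cdot\rangle_\bullet$ (linear in the second variable) such that: (i) the linear span of $\{{}_\bullet\langle f,g\rangle\}$ is dense in $A$ and that of $\{\langle f,g\rangle_\bullet\}$ is dense in $B$; (ii) $\langle af,g\rangle_\bullet=\langle f,a^*g\rangle_\bullet$ and ${}_\bullet\langle fb,g\rangle={}_\bullet\langle f,gb^*\rangle$; (iii) ${}_\bullet\langle f,g\rangle h=f\langle g,h\rangle_\bullet$, for all $f,g,h\in E$, $a\in A$, $b\in B$. A left Gabor bimodule is a quadruple $(A,B,E,\mathrm{tr}_B)$ where $A,B$ are $C^*$-algebras, $B$ is unital, $\mathrm{tr}_B$ is a faithful finite (positive) trace on $B$, and $E$ is an $A$-$B$-equivalence bimodule. Let $\mathrm{tr}_A$ be the unique lower semicontinuous (possibly unbounded) trace on $A$ with $\mathrm{tr}_A({}_\bullet\langle f,g\rangle)=\mathrm{tr}_B(\langle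 g,f\rangle_\bullet)$ for all $f,g\in E$. Put $(f,g)_E=\mathrm{tr}_A({}_\bullet\langle f,g\rangle)=\mathrm{tr}_B(\langle g,f\rangle_\bullet)$; this is an inner product on $E$, $H_E$ denotes the Hilbert space completion, and the right action of $B$ on $E$ extends by continuity to $H_E$. An element $g\in E$ generates a module frame for $E$ if the operator $\Theta_g:E\to E$, $\Theta_gf={}_\bullet\langle f,g\rangle g$, is invertible. *)

(* Defs.v *)
From HB Require Import structures.
From mathcomp Require Import all_boot all_order all_algebra.
From mathcomp Require Import complex.
From mathcomp Require Import boolp classical_sets functions reals.
From mathcomp Require Import topology normedtype.

Set Implicit Arguments.
Unset Strict Implicit.
Unset Printing Implicit Defensive.

Import Order.TTheory GRing.Theory Num.Theory.
Import numFieldNormedType.Exports.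

Local Open Scope classical_set_scope.
Local Open Scope complex_scope.
Local Open Scope ring_scope.

(* C*-algebras are not assumed unital, so they are not built on pzRingType. *)
HB.mixin Record isCStarAlgebra (R : realType) A
    of CompleteNormedModule R[i] A := {
  cmul : A -> A -> A;
  star : A -> A;
  cmulA : forall a b c : A, cmul a (cmul b c) = cmul (cmul a b) c;
  cmul_linearl : forall (k : R[i]) (a b c : A),
    cmul (k *: a + b) c = k *: cmul a c + cmul b c;
  cmul_linearr : forall (k : R[i]) (a b c : A),
    cmul c (k *: a + b) = k *: cmul c a + cmul c b;
  starK : forall a : A, star (star a) = a;
  star_antilinear : forall (k : R[i]) (a b : A),
    star (k *: a + b) = Num.conj k *: star a + star b;
  starM : forall a b : A, star (cmul a b) = cmul (star b) (star a);
  cmul_norm : forall a b : A, `|cmul a b| <= `|a| * `|b|;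
  cstar_norm : forall a : A, `|cmul (star a) a| = `|a| ^+ 2
}.

#[short(type="cstarAlgType")]
HB.structure Definition CStarAlgebra (R : realType) :=
  {A of isCStarAlgebra R A & CompleteNormedModule R[i] A}.

Definition cpositive (R : realType) (A : cstarAlgType R) (a : A) : Prop :=
  exists x : A, a = cmul (star x) x.

Definition cunital (R : realType) (A : cstarAlgType R) : Prop :=
  exists e : A, forall a : A, cmul e a = a /\ cmul a e = a.

Definition lin_span (K : pzRingType) (V : lmodType K) (S : set V) : set V :=
  [set x | exists n (c : 'I_n -> K) (v : 'I_n -> V),
     (forall i, S (v i)) /\ x = \sum_i c i *: v i].

(* The Hilbert modules below carry no topology of their own: a bimodule has
   one norm from each inner product, and is complete for both. *)
Definition complete_for (K : numDomainType) (V : zmodType) (N : V -> K) : Prop :=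
  forall u : nat -> V,
    (forall e : K, 0 < e -> exists n0 : nat, forall m n : nat,
       (n0 <= m)%N -> (n0 <= n)%N -> N (u m - u n) < e) ->
    exists l : V, forall e : K, 0 < e -> exists n0 : nat, forall n : nat,
      (n0 <= n)%N -> N (u n - l) < e.

HB.mixin Record isLeftHilbertModule (R : realType) (A : cstarAlgType R) E
    of GRing.Lmodule R[i] E := {
  lact : A -> E -> E;
  lip : E -> E -> A;
  lactM : forall (a b : A) (f : E), lact (cmul a b) f = lact a (lact b f);
  lact_linearl : forall (k : R[i]) (a b : A) (f : E),
    lact (k *: a + b) f = k *: lact a f + lact b f;
  lact_linearr : forall (k : R[i]) (a : A) (f g : E),
    lact a (k *: f + g) = k *: lact a f + lact a g;
  lip_linear : forall (k : R[i]) (f g h : E),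
    lip (k *: f + g) h = k *: lip f h + lip g h;
  lip_act : forall (a : A) (f g : E), lip (lact a f) g = cmul a (lip f g);
  lip_star : forall f g : E, star (lip f g) = lip g f;
  lip_ge0 : forall f : E, cpositive (lip f f);
  lip_eq0 : forall f : E, lip f f = 0 -> f = 0;
  lip_complete : complete_for (fun f : E => sqrtC `|lip f f|)
}.

#[short(type="leftHilbertModType")]
HB.structure Definition LeftHilbertModule (R : realType) (A : cstarAlgType R) :=
  {E of isLeftHilbertModule R A E & GRing.Lmodule R[i] E}.

HB.mixin Record isRightHilbertModule (R : realType) (B : cstarAlgType R) E
    of GRing.Lmodule R[i] E := {
  ract : E -> B -> E;
  rip : E -> E -> B;
  ractM : forall (f : E) (a b : B), ract f (cmul a b) = ract (ract f a) b;
  ract_linearr : forall (k : R[i]) (f : E) (a b : B),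
    ract f (k *: a + b) = k *: ract f a + ract f b;
  ract_linearl : forall (k : R[i]) (f g : E) (b : B),
    ract (k *: f + g) b = k *: ract f b + ract g b;
  rip_linear : forall (k : R[i]) (f g h : E),
    rip h (k *: f + g) = k *: rip h f + rip h g;
  rip_act : forall (f g : E) (b : B), rip f (ract g b) = cmul (rip f g) b;
  rip_star : forall f g : E, star (rip f g) = rip g f;
  rip_ge0 : forall f : E, cpositive (rip f f);
  rip_eq0 : forall f : E, rip f f = 0 -> f = 0;
  rip_complete : complete_for (fun f : E => sqrtC `|rip f f|)
}.

#[short(type="rightHilbertModType")]
HB.structure Definition RightHilbertModule (R : realType) (B : cstarAlgType R) :=
  {E of isRightHilbertModule R B E & GRing.Lmodule R[i] E}.

HB.mixin Record isEquivalenceBimodule (R : realType) (A B : cstarAlgType R) E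
    of LeftHilbertModule R A E & RightHilbertModule R B E := {
  lractA : forall (a : A) (f : E) (b : B),
    ract (lact a f) b = lact a (ract f b);
  lip_full : dense (lin_span [set a : A | exists f g : E, a = lip f g]);
  rip_full : dense (lin_span [set b : B | exists f g : E, b = rip f g]);
  rip_lact : forall (a : A) (f g : E),
    rip (lact a f) g = rip f (lact (star a) g) :> B;
  lip_ract : forall (f g : E) (b : B),
    lip (ract f b) g = lip f (ract g (star b)) :> A;
  lip_rip : forall f g h : E,
    lact (lip f g : A) h = ract f (rip g h : B)
}.

#[short(type="equivBimodType")]
HB.structure Definition EquivalenceBimodule (R : realType)
    (A B : cstarAlgType R) :=
  {E of isEquivalenceBimodule R A B E &
        LeftHilbertModule R A E & RightHilbertModule R B E}.

(* In the order of R[i], 0 <= z says that z is real and nonnegative. *)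
Definition faithful_trace (R : realType) (B : cstarAlgType R)
    (tr : {scalar B}) : Prop :=
  [/\ forall a b : B, tr (cmul a b) = tr (cmul b a),
      forall b : B, cpositive b -> 0 <= tr b
    & forall b : B, cpositive b -> tr b = 0 -> b = 0].

Record leftGaborBimodule (R : realType) := LeftGaborBimodule {
  gaborA : cstarAlgType R;
  gaborB : cstarAlgType R;
  gaborE :> equivBimodType gaborA gaborB;
  gabor_tr : {scalar gaborB};
  gaborB_unital : cunital gaborB;
  gabor_tr_faithful : faithful_trace gabor_tr
}.

Definition glact (R : realType) (G : leftGaborBimodule R) :
  gaborA G -> G -> G := @lact R (gaborA G) (gaborE G).
Definition gract (R : realType) (G : leftGaborBimodule R) :
  G -> gaborB G -> G := @ract R (gaborB G) (gaborE G).
Definition glip (R : realType) (G : leftGaborBimodule R) :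
  G -> G -> gaborA G := @lip R (gaborA G) (gaborE G).
Definition grip (R : realType) (G : leftGaborBimodule R) :
  G -> G -> gaborB G := @rip R (gaborB G) (gaborE G).

(* (f, g)_E, linear in f; it is also tr_A of the A-valued inner product of f
   and g, for the trace tr_A on A induced by tr_B. *)
Definition gdot (R : realType) (G : leftGaborBimodule R) (f g : G) : R[i] :=
  gabor_tr G (grip g f).

HB.mixin Record isHilbertSpace (R : realType) H
    of CompleteNormedModule R[i] H := {
  hdot : H -> H -> R[i];
  hdot_linear : forall (k : R[i]) (x y z : H),
    hdot (k *: x + y) z = k * hdot x z + hdot y z;
  hdot_conj : forall x y : H, Num.conj (hdot x y) = hdot y x;
  hdot_norm : forall x : H, hdot x x = `|x| ^+ 2
}.

#[short(type="hilbertType")]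
HB.structure Definition HilbertSpace (R : realType) :=
  {H of isHilbertSpace R H & CompleteNormedModule R[i] H}.

(* A completion H_E of E for gdot, with the extension by continuity of the
   right action of B; all of it is determined by G up to unitary isomorphism. *)
Record gaborCompletion (R : realType) (G : leftGaborBimodule R) :=
  GaborCompletion {
  gc_space :> hilbertType R;
  gc_incl : {linear G -> gc_space};
  gc_act : gc_space -> gaborB G -> gc_space;
  gc_incl_dot : forall f g : G, hdot (gc_incl f) (gc_incl g) = gdot f g;
  gc_incl_dense : dense (range gc_incl);
  gc_act_incl : forall (f : G) (b : gaborB G),
    gc_act (gc_incl f) b = gc_incl (gract f b);
  gc_act_continuous : forall b : gaborB G, continuous (gc_act^~ b)
}.

Definition frame_op (R : realType) (G : leftGaborBimodule R) (g : G) : G -> G :=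
  fun f => glact (glip f g) g.

Definition generates_module_frame (R : realType) (G : leftGaborBimodule R)
    (g : G) : Prop := bijective (frame_op g).

Definition frame_bounds (R : realType) (G : leftGaborBimodule R)
    (H : gaborCompletion G) (g : G) (C D : R) : Prop :=
  forall f : H,
    C%:C * hdot f f <= hdot (gc_act f (grip g g)) f <= D%:C * hdot f f.

(* Main.v *)
Require Import Defs.
From mathcomp Require Import all_boot all_order all_algebra.
From mathcomp Require Import complex lra ring.
From mathcomp Require Import boolp classical_sets reals.
From mathcomp Require Import topology normedtype sequences.

(** Everything turns on [b := <g, g>], the right inner product of [g] with
    itself: the frame operator is right multiplication by [b], and both sides
    of the two equivalences hold exactly when [b] is invertible in [B].

    - A dual generator [h] is an [h] with [<g, h> = 1], because [B] acts
      faithfully on the full module [E] ([dual_rip]). Then, for [K] larger than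
      the norm of [<h, h>], expanding the positive element
      [<g - h/K, g - h/K>] shows that [b - 1/K] is positive, while [D - b] is
      positive for [D] larger than the norm of [b]; evaluating the positive
      functional [y |-> tr (<f, f> y)] gives the inequalities on [E]
      ([dual_form_bounds]), and density extends them to the completion
      ([frame_bounds_completion]).

    - Conversely the lower bound says that [t := (b - C/2)/M] is strictly
      positive as a quadratic form on [E], where [M] scales [t] into the unit
      ball. Let [w = |t|]. For [k = f (w - t)] one has [k (w + t) = 0], as
      [w] commutes with [t] and has the same square; but [w + t] is strictly
      positive as a form, so [k = 0]. Faithfulness of the action gives
      [t = |t|], hence [b = M |t| + C/2], which is invertible
      ([form_bound_invertible]). If [b c = 1] then [h = g c] is a dual
      generator and multiplication by [c] inverts the frame operator.

    - If the frame operator is bijective, its inverse is left [A]-linear, and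
      applying it to [g] produces a dual generator.

    The order estimates rest on square roots. The square root of [1 - x], for
    a self-adjoint [x] in the closed unit ball, is the limit of an explicit
    iteration ([cstar_sqrt]), and the absolute value [|t|] is obtained by
    applying it to [x = 1 - t^2]. That [1 - t^2] has norm at most 1 is seen by writing [t] as
    the real part of the unitary [t + i sqrt (1 - t^2)] ([rnorm_sub_sqr]). *)

Set Implicit Arguments.
Unset Strict Implicit.
Unset Printing Implicit Defensive.

Import Order.TTheory GRing.Theory Num.Theory.
Import numFieldNormedType.Exports.

Local Open Scope classical_set_scope.
Local Open Scope complex_scope.
Local Open Scope ring_scope.

(** * Real-valued norms and convergence *)

(** The norm of a complex normed module takes its values in [R[i]]; its real
    part lives in the totally ordered field [R], where [lra] and [nra] apply. *)
Definition rnorm (R : realType) (V : normedModType R[i]) (v : V) : R :=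
  complex.Re `|v|.

Lemma rnormE (R : realType) (V : normedModType R[i]) (v : V) :
  `|v| = (rnorm v)%:C.
Proof. by apply/esym/RRe_real; rewrite realE normr_ge0. Qed.

Lemma rnorm_ge0 (R : realType) (V : normedModType R[i]) (v : V) : 0 <= rnorm v.
Proof. by have := normr_ge0 v; rewrite rnormE lecR. Qed.

Lemma rnorm_eq0 (R : realType) (V : normedModType R[i]) (v : V) :
  rnorm v = 0 -> v = 0.
Proof. by move=> v0; apply/eqP; rewrite -normr_eq0 rnormE v0. Qed.

Lemma rnorm0 (R : realType) (V : normedModType R[i]) : rnorm (0 : V) = 0.
Proof. by rewrite /rnorm normr0. Qed.

Lemma rnormN (R : realType) (V : normedModType R[i]) (v : V) :
  rnorm (- v) = rnorm v.
Proof. by rewrite /rnorm normrN. Qed.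

Lemma rnormD (R : realType) (V : normedModType R[i]) (u v : V) :
  rnorm (u + v) <= rnorm u + rnorm v.
Proof. by have := ler_normD u v; rewrite !rnormE -rmorphD lecR. Qed.

Lemma rnormB (R : realType) (V : normedModType R[i]) (u v : V) :
  rnorm (u - v) <= rnorm u + rnorm v.
Proof. by rewrite -(rnormN v) rnormD. Qed.

Lemma rnormZ (R : realType) (V : normedModType R[i]) (k : R) (v : V) :
  rnorm (k%:C *: v) = `|k| * rnorm v.
Proof.
rewrite /rnorm normrZ normc_def /= expr0n /= addr0 sqrtr_sqr.
by rewrite rnormE -rmorphM.
Qed.

Lemma rnorm_telescope (R : realType) (V : normedModType R[i])
    (z : nat -> V) (s : nat -> R) :
  (forall n, rnorm (z n.+1 - z n) <= s n.+1 - s n) ->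
  forall m k, rnorm (z (m + k)%N - z m) <= s (m + k)%N - s m.
Proof.
move=> zs m; elim=> [|k IHk]; first by rewrite addn0 !subrr rnorm0.
rewrite addnS -(subrKA (z (m + k)%N)); apply: le_trans (rnormD _ _) _.
by have := zs (m + k)%N; lra.
Qed.

(** The method of majorants: a bounded real sequence whose increments dominate
    those of [z] is nondecreasing, hence Cauchy, and so [z] is Cauchy too.
    Unlike a geometric estimate, this allows increments with no uniform ratio,
    as needed for square roots on the boundary of the unit ball. *)
Lemma majorized_cvg (R : realType) (V : completeNormedModType R[i])
    (z : nat -> V) (s : nat -> R) (M : R) :
  (forall n, rnorm (z n.+1 - z n) <= s n.+1 - s n) ->
  (forall n, s n <= M) ->
  exists l : V, forall e : R, 0 < e ->
    exists N, forall n, (N <= n)%N -> rnorm (z n - l) < e.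
Proof.
move=> zs sM.
have tele := rnorm_telescope zs.
have s_nd : nondecreasing_seq s.
  apply/nondecreasing_seqP => n; rewrite -subr_ge0.
  exact: le_trans (rnorm_ge0 _) (zs n).
have s_cvg : cvgn s.
  by apply: nondecreasing_is_cvgn => //; exists M => _ [n _ <-].
have s_le n : s n <= limn s by exact: nondecreasing_cvgn_le.
have z_cauchy : cauchy (z @ \oo).
  apply/cauchy_exP => e e0.
  have e0' : 0 < complex.Re e by move: e0; rewrite ltcE /= => /andP[].
  have eE : e = (complex.Re e)%:C.
    by apply/esym/RRe_real; rewrite realE (ltW e0).
  move/cvgrPdist_lt: s_cvg => /(_ _ e0')[N _ HN].
  exists (z N); exists N => // n /= Nn.
  rewrite -ball_normE /= distrC rnormE eE ltcR.
  rewrite -(subnKC Nn); apply: le_lt_trans (tele _ _) _.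
  have := HN N (leqnn N); rewrite /= ger0_norm ?subr_ge0 ?s_le //.
  by have := s_le (N + (n - N))%N; lra.
have /cauchy_cvgP /cvgrPdist_lt zl := z_cauchy.
exists (lim (z @ \oo)) => e e0.
have /zl[N _ HN] : (0 : R[i]) < e%:C by rewrite ltcR.
exists N => n Nn; have := HN n Nn.
by rewrite /= distrC rnormE ltcR.
Qed.

Lemma rnorm_small_eq0 (R : realType) (V : normedModType R[i]) (v : V) (K : R) :
  0 < K -> (forall e : R, 0 < e -> rnorm v <= K * e) -> v = 0.
Proof.
move=> K0 small; apply: rnorm_eq0; apply/eqP; rewrite eq_le rnorm_ge0 andbT.
rewrite leNgt; apply/negP => v0.
have e0 : 0 < rnorm v / (2 * K) by rewrite divr_gt0 // mulr_gt0.
have := small _ e0.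
have -> : K * (rnorm v / (2 * K)) = rnorm v / 2.
  by field; rewrite gt_eqF.
by lra.
Qed.

(** * Elementary algebra in a C*-algebra *)

Section CStarAlgebraTheory.
Variables (R : realType) (A : cstarAlgType R).
Implicit Types a b c : A.

Lemma cmulDl a b c : cmul (a + b) c = cmul a c + cmul b c.
Proof. by have := cmul_linearl 1 a b c; rewrite !scale1r. Qed.

Lemma cmulDr a b c : cmul c (a + b) = cmul c a + cmul c b.
Proof. by have := cmul_linearr 1 a b c; rewrite !scale1r. Qed.

Lemma cmul0l a : cmul 0 a = 0.
Proof. by apply: (addrI (cmul 0 a)); rewrite -cmulDl !addr0. Qed.

Lemma cmul0r a : cmul a 0 = 0.
Proof. by apply: (addrI (cmul a 0)); rewrite -cmulDr !addr0. Qed.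

Lemma cmulZl (k : R[i]) a b : cmul (k *: a) b = k *: cmul a b.
Proof. by have := cmul_linearl k a 0 b; rewrite cmul0l !addr0. Qed.

Lemma cmulZr (k : R[i]) a b : cmul a (k *: b) = k *: cmul a b.
Proof. by have := cmul_linearr k b 0 a; rewrite cmul0r !addr0. Qed.

Lemma cmulNl a b : cmul (- a) b = - cmul a b.
Proof. by rewrite -scaleN1r cmulZl scaleN1r. Qed.

Lemma cmulNr a b : cmul a (- b) = - cmul a b.
Proof. by rewrite -scaleN1r cmulZr scaleN1r. Qed.

Lemma cmulBl a b c : cmul (a - b) c = cmul a c - cmul b c.
Proof. by rewrite cmulDl cmulNl. Qed.

Lemma cmulBr a b c : cmul c (a - b) = cmul c a - cmul c b.
Proof. by rewrite cmulDr cmulNr. Qed.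

Lemma starD a b : star (a + b) = star a + star b.
Proof. by have := star_antilinear 1 a b; rewrite rmorph1 !scale1r. Qed.

Lemma star0 : star (0 : A) = 0.
Proof. by apply: (addrI (star 0)); rewrite -starD !addr0. Qed.

Lemma starZ (k : R[i]) a : star (k *: a) = Num.conj k *: star a.
Proof. by have := star_antilinear k a 0; rewrite star0 !addr0. Qed.

Lemma starZr (k : R) a : star (k%:C *: a) = k%:C *: star a.
Proof. by rewrite starZ; congr (_ *: _); apply: conj_Creal; rewrite complex_real. Qed.

Lemma starN a : star (- a) = - star a.
Proof. by rewrite -scaleN1r starZ rmorphN rmorph1 scaleN1r. Qed.

Lemma starB a b : star (a - b) = star a - star b.
Proof. by rewrite starD starN. Qed.

Lemma rnormM a b : rnorm (cmul a b) <= rnorm a * rnorm b.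
Proof. by have := cmul_norm a b; rewrite !rnormE -rmorphM lecR. Qed.

Lemma rnorm_starM a : rnorm (cmul (star a) a) = rnorm a ^+ 2.
Proof. by have := cstar_norm a; rewrite !rnormE -rmorphXn => -[]. Qed.

Lemma rnorm_star a : rnorm (star a) = rnorm a.
Proof.
suff le b : rnorm b <= rnorm (star b).
  by apply/eqP; rewrite eq_le le -{2}(starK a) le.
have := rnorm_starM b; have := rnormM (star b) b.
have := rnorm_ge0 b; have := rnorm_ge0 (star b).
by move=> h1 h2 h3 h4; nra.
Qed.
End CStarAlgebraTheory.

(** * Square roots and absolute values in a unital C*-algebra *)

Section UnitalCStarAlgebra.
Variables (R : realType) (B : cstarAlgType R) (e : B).
Hypothesis he : forall a : B, cmul e a = a /\ cmul a e = a.
Implicit Types a b x y z t w : B.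

Let cmul1l a : cmul e a = a. Proof. by case: (he a). Qed.
Let cmul1r a : cmul a e = a. Proof. by case: (he a). Qed.

Lemma star_unit : star e = e.
Proof. by rewrite -[RHS](starK e) -{2}(cmul1r (star e)) starM starK cmul1r. Qed.

Lemma rnorm_unit : rnorm e <= 1.
Proof.
have := rnorm_starM e; rewrite star_unit cmul1l => h.
by have := rnorm_ge0 e; nra.
Qed.

(** With [y = 1 - z], the equation [y^2 = 1 - x] is the fixed-point equation
    [z = (x + z^2)/2]. Iterating from [0], the increments are dominated by
    those of the scalar iteration [s |-> (1 + s^2)/2], which increases to 1;
    so the limit exists even when [x] has norm 1. Every iterate is self-adjoint
    and commutes with whatever commutes with [x], and the limit inherits this. *)
Lemma cstar_sqrt x : star x = x -> rnorm x <= 1 ->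
  exists z, [/\ star z = z, rnorm z <= 1,
    cmul (e - z) (e - z) = e - x
  & forall a, cmul a x = cmul x a -> cmul a z = cmul z a].
Proof.
move=> xs x1.
pose step z := (2^-1 : R)%:C *: (x + cmul z z).
pose zs n := iter n step 0.
pose ss n : R := iter n (fun s => 2^-1 * (1 + s ^+ 2)) 0.
have zsS n : zs n.+1 = step (zs n) by [].
have ssS n : ss n.+1 = 2^-1 * (1 + ss n ^+ 2) by [].
have ss01 n : 0 <= ss n <= 1.
  by elim: n => [|n /andP[h0 h1]]; rewrite ?ssS; apply/andP; split; rewrite //=; nra.
have zs_le n : rnorm (zs n) <= ss n.
  elim: n => [|n IHn]; first by rewrite rnorm0.
  rewrite zsS ssS rnormZ ger0_norm ?invr_ge0 // ler_wpM2l ?invr_ge0 //.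
  apply: le_trans (rnormD _ _) _; apply: lerD => //.
  by apply: le_trans (rnormM _ _) _; have := rnorm_ge0 (zs n); nra.
have sqrB y z : cmul y y - cmul z z = cmul (y - z) y + cmul z (y - z).
  by rewrite cmulBl cmulBr subrKA.
have stepB y z : step y - step z = (2^-1 : R)%:C *: (cmul y y - cmul z z).
  by rewrite -scalerBr opprD addrACA subrr add0r.
have half_ge0 : 0 <= 2^-1 :> R by rewrite invr_ge0.
have stepB_le y z : rnorm (step y - step z) <=
    2^-1 * (rnorm (y - z) * (rnorm y + rnorm z)).
  rewrite stepB rnormZ ger0_norm // ler_wpM2l //.
  rewrite sqrB mulrDr; apply: le_trans (rnormD _ _) _; apply: lerD.
    exact: rnormM.
  by rewrite mulrC; exact: rnormM.
have zsB n : rnorm (zs n.+1 - zs n) <= ss n.+1 - ss n.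
  elim: n => [|n IHn].
    have := zs_le 1%N; rewrite [zs 0%N]/= [ss 0%N]/= !subr0; exact.
  rewrite (zsS n.+1) [X in rnorm (_ - X) <= _]zsS.
  apply: le_trans (stepB_le _ _) _.
  rewrite (ssS n.+1) [X in _ <= _ - X]ssS.
  have h1 := zs_le n.+1; have h2 := zs_le n; have h3 := rnorm_ge0 (zs n.+1).
  have h4 := rnorm_ge0 (zs n); have h5 := rnorm_ge0 (zs n.+1 - zs n).
  rewrite -mulrBr ler_wpM2l //.
  have -> : 1 + ss n.+1 ^+ 2 - (1 + ss n ^+ 2) =
    (ss n.+1 - ss n) * (ss n.+1 + ss n) by ring.
  by apply: ler_pM => //; [exact: addr_ge0|exact: lerD].
have [|z zlim] := majorized_cvg zsB (M := 1).
  by move=> n; case/andP: (ss01 n).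
have z_near d : 0 < d -> exists n,
    rnorm (zs n - z) < d /\ rnorm (zs n.+1 - z) < d.
  move=> /zlim[N HN]; exists N; split; apply: HN => //; exact: ltnW.
have zs1 n : rnorm (zs n) <= 1.
  by have := zs_le n; have := ss01 n; move=> /andP[_]; lra.
have z1 : rnorm z <= 1.
  apply/ler_addgt0Pr => d /z_near[n [zn _]].
  rewrite -(subKr (zs n) z); apply: le_trans (rnormB _ _) _.
  by have := zs1 n; lra.
have zstep : step z = z.
  apply/eqP; rewrite -subr_eq0; apply/eqP.
  apply: (@rnorm_small_eq0 _ _ _ 2) => // d /z_near[n [zn zn1]].
  rewrite -(subrKA (zs n.+1)) zsS; apply: le_trans (rnormD _ _) _.
  rewrite -zsS; have := stepB_le (zs n) z; rewrite -zsS -rnormN opprB.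
  have := zs1 n; have := rnorm_ge0 (zs n); have := rnorm_ge0 z.
  have := rnorm_ge0 (zs n - z); nra.
exists z; split => //.
- apply/eqP; rewrite -subr_eq0; apply/eqP.
  apply: (@rnorm_small_eq0 _ _ _ 2) => // d /z_near[n [zn _]].
  have zsn : star (zs n) = zs n.
    elim: n {zn} => [|n IHn]; first by rewrite star0.
    by rewrite zsS starZr starD starM xs IHn.
  rewrite -(subrKA (zs n)) -{1}zsn -starB; apply: le_trans (rnormD _ _) _.
  by rewrite rnorm_star -(rnormN (z - _)) opprB; lra.
- have zz : z + z = x + cmul z z.
    rewrite -{1 2}zstep /step -scalerDl -rmorphD /=.
    have -> : 2^-1 + 2^-1 = 1 :> R by field.
    by rewrite rmorph1 scale1r.
  by rewrite cmulBl !cmulBr !cmul1l cmul1r -addrA -opprD addrA zz addrK.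
- move=> a ax; apply/eqP; rewrite -subr_eq0; apply/eqP.
  apply: (@rnorm_small_eq0 _ _ _ (2 * rnorm a + 1)).
    by have := rnorm_ge0 a; lra.
  move=> d d0; have [n [zn _]] := z_near d d0.
  have azn : cmul a (zs n) = cmul (zs n) a.
    elim: n {zn} => [|n IHn]; first by rewrite cmul0l cmul0r.
    rewrite zsS cmulZl cmulZr cmulDl cmulDr ax cmulA IHn -cmulA IHn.
    by rewrite cmulA.
  rewrite -(subrKA (cmul a (zs n))) {2}azn -cmulBr -cmulBl.
  apply: le_trans (rnormD _ _) _.
  have := rnormM a (z - zs n); have := rnormM (zs n - z) a.
  rewrite -(rnormN (z - _)) opprB.
  by have := rnorm_ge0 a; have := rnorm_ge0 (zs n - z); nra.
Qed.

(** Rescaling [x] by [1/k] brings it into the unit ball, where the difference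
    has a self-adjoint square root. *)
Lemma cpositive_sub x (k : R) : star x = x -> rnorm x <= k -> 0 < k ->
  cpositive (k%:C *: e - x).
Proof.
move=> xs xk k0.
have [||z [zs _ zE _]] := @cstar_sqrt ((k^-1)%:C *: x).
- by rewrite starZr xs.
- by rewrite rnormZ ger0_norm ?invr_ge0 ?(ltW k0) // mulrC ler_pdivrMr // mul1r.
exists ((Num.sqrt k)%:C *: (e - z)).
rewrite starZr starB star_unit zs cmulZl cmulZr scalerA -rmorphM zE.
rewrite -expr2 sqr_sqrtr ?(ltW k0) // scalerBr scalerA -rmorphM mulfV ?gt_eqF //.
by rewrite rmorph1 scale1r.
Qed.

(** With [r] a square root of [1 - t^2] commuting with [t], the element
    [u = t + i r] satisfies [u* u = 1]. Its imaginary part [r] therefore has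
    norm at most 1, and so does [r^2]. *)
Lemma rnorm_sub_sqr t : star t = t -> rnorm t <= 1 -> rnorm (e - cmul t t) <= 1.
Proof.
move=> ts t1.
have [||z [zs _ zE zc]] := @cstar_sqrt (cmul t t).
- by rewrite starM ts.
- by apply: le_trans (rnormM _ _) _; have := rnorm_ge0 t; nra.
set r := e - z in zE.
have rs : star r = r by rewrite starB star_unit zs.
have tr : cmul t r = cmul r t.
  by rewrite cmulBl cmulBr cmul1l cmul1r zc // cmulA.
pose u := t + 'i *: r.
have us : star u = t - 'i *: r by rewrite starD starZ conjCi ts rs scaleNr.
have u1 : rnorm u <= 1.
  have : rnorm (cmul (star u) u) <= 1.
    rewrite us cmulDr !cmulBl !cmulZl !cmulZr scalerA -expr2 sqrCi.
    by rewrite scaleN1r opprK tr subrKA zE addrC subrK rnorm_unit.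
  by rewrite rnorm_starM; have := rnorm_ge0 u; nra.
have rE : (2 : R)%:C *: r = 'i *: (star u - u).
  rewrite us /u opprD addrACA subrr add0r -opprD scalerN -scalerDr scalerA.
  by rewrite -expr2 sqrCi scaleN1r opprK rmorphD rmorph1 scalerDl scale1r.
rewrite -zE; apply: le_trans (rnormM _ _) _.
suff : rnorm r <= 1 by have := rnorm_ge0 r; nra.
have : rnorm ((2 : R)%:C *: r) <= 2.
  rewrite rE /rnorm normrZ normCi mul1r.
  apply: le_trans (rnormB _ _) _.
  by rewrite rnorm_star; lra.
by rewrite rnormZ ger0_norm //; lra.
Qed.

(** The element [w] is the absolute value [|t|]; the bound on [1 - w] is the
    form in which its positivity is used, since it makes [w] the square of a
    self-adjoint element and [w + c] invertible for [c > 0]. *)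
Lemma cstar_abs t : star t = t -> rnorm t <= 1 ->
  exists w, [/\ star w = w, cmul w w = cmul t t, cmul w t = cmul t w
              & rnorm (e - w) <= 1].
Proof.
move=> ts t1.
have [||z [zs z1 zE zc]] := @cstar_sqrt (e - cmul t t).
- by rewrite starB star_unit starM ts.
- exact: rnorm_sub_sqr.
exists (e - z); split; first by rewrite starB star_unit zs.
- by rewrite zE subKr.
- by rewrite cmulBl cmulBr cmul1l cmul1r zc // cmulBl cmulBr cmul1l cmul1r cmulA.
- by rewrite subKr.
Qed.

(** The Neumann series gives a right inverse; applied to [star x] it also gives
    a left inverse. *)
Lemma invertible_near_unit x : rnorm x < 1 ->
  exists c, cmul (e - x) c = e /\ cmul c (e - x) = e.
Proof.
move=> x1.
have right y : rnorm y < 1 -> exists c, cmul (e - y) c = e.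
  move=> y1; have y0 := rnorm_ge0 y.
  pose step c := e + cmul y c.
  pose cs n := iter n step 0.
  pose ss n : R := iter n (fun s => 1 + rnorm y * s) 0.
  have csB n : rnorm (cs n.+1 - cs n) <= ss n.+1 - ss n.
    elim: n => [|n IHn].
      by rewrite /= /step cmul0r !subr0 mulr0 !addr0 rnorm_unit.
    rewrite -[cs n.+2]/(step (cs n.+1)) -[X in rnorm (_ - X)]/(step (cs n)).
    rewrite /step opprD addrACA subrr add0r -cmulBr.
    rewrite -[ss n.+2]/(1 + rnorm y * ss n.+1).
    rewrite -[X in _ <= _ - X]/(1 + rnorm y * ss n).
    rewrite opprD addrACA subrr add0r -mulrBr.
    by apply: le_trans (rnormM _ _) _; rewrite ler_wpM2l.
  have ss_le n : ss n <= (1 - rnorm y)^-1.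
    elim: n => [|n IHn]; first by rewrite invr_ge0 subr_ge0 ltW.
    rewrite -[ss n.+1]/(1 + rnorm y * ss n).
    have -> : (1 - rnorm y)^-1 = 1 + rnorm y * (1 - rnorm y)^-1.
      by field; rewrite subr_eq0 gt_eqF.
    by rewrite lerD2l ler_wpM2l.
  have [c clim] := majorized_cvg csB ss_le.
  exists c; rewrite cmulBl cmul1l.
  apply/eqP; rewrite -subr_eq0; apply/eqP.
  apply: (@rnorm_small_eq0 _ _ _ 2) => // d /clim[N HN].
  have -> : c - cmul y c - e = c - cs N.+1 + cmul y (cs N - c).
    rewrite -[cs N.+1]/(e + cmul y (cs N)) cmulBr opprD !addrA.
    by rewrite subrK addrAC.
  apply: le_trans (rnormD _ _) _; rewrite -(rnormN (c - _)) opprB.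
  have := rnormM y (cs N - c); have := HN N (leqnn N).
  have := HN N.+1 (leqnSn N); have := rnorm_ge0 (cs N - c); nra.
have [c cE] := right x x1.
have [|c' c'E] := right (star x); first by rewrite rnorm_star.
have {}c'E : cmul (star c') (e - x) = e.
  by rewrite -[e - x]starK -starM starB star_unit c'E star_unit.
exists c; split=> //.
suff -> : c = star c' by [].
by rewrite -[c]cmul1l -c'E -cmulA cE cmul1r.
Qed.

End UnitalCStarAlgebra.

(** * Continuity in a Hilbert space *)

Section Hilbert.
Variables (R : realType) (H : hilbertType R).
Implicit Types x y z : H.

Lemma hdotDl x y z : hdot (x + y) z = hdot x z + hdot y z.
Proof. by have := hdot_linear 1 x y z; rewrite scale1r mul1r. Qed.

Lemma hdotZl (k : R[i]) x z : hdot (k *: x) z = k * hdot x z.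
Proof.
have h0 : hdot 0 z = 0 by apply: (addrI (hdot 0 z)); rewrite -hdotDl !addr0.
by have := hdot_linear k x 0 z; rewrite h0 !addr0.
Qed.

Lemma hdotDr x y z : hdot z (x + y) = hdot z x + hdot z y.
Proof. by rewrite -hdot_conj hdotDl rmorphD /= !hdot_conj. Qed.

Lemma hdotZr (k : R[i]) x z : hdot z (k *: x) = Num.conj k * hdot z x.
Proof. by rewrite -hdot_conj hdotZl rmorphM /= hdot_conj. Qed.

(** This reduces the continuity of the inner product to that of the norm. *)
Lemma hdot_polarization x y : hdot x y =
  4^-1 * (`|x + y| ^+ 2 - `|x + (-1) *: y| ^+ 2
          + 'i * (`|x + 'i *: y| ^+ 2 - `|x + (- 'i) *: y| ^+ 2)).
Proof.
rewrite -!hdot_norm !(hdotDl, hdotDr, hdotZl, hdotZr).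
rewrite !rmorphN !rmorph1 /= !conjCi.
have i2 : 'i * 'i = -1 :> R[i] by rewrite -expr2 sqrCi.
set a := hdot x x; set b := hdot x y; set c := hdot y x; set d := hdot y y.
transitivity (4^-1 * (2 * b + 2 * c - ('i * 'i) * (2 * b - 2 * c))).
  by rewrite i2; field.
by field.
Qed.

Lemma continuous_hdot (u v : H -> H) : continuous u -> continuous v ->
  continuous (fun x => hdot (u x) (v x) : (R[i] : numFieldType)).
Proof.
move=> uc vc.
have -> : (fun x => hdot (u x) (v x) : (R[i] : numFieldType)) = (fun x =>
    4^-1 * (`|u x + v x| ^+ 2 - `|u x + (-1) *: v x| ^+ 2
          + 'i * (`|u x + 'i *: v x| ^+ 2 - `|u x + (- 'i) *: v x| ^+ 2))).
  by apply/funext => x; exact: hdot_polarization.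
have sq w : continuous w -> continuous (fun x => `|w x : H| ^+ 2 : (R[i] : numFieldType)).
  move=> wc x; rewrite /continuous_at.
  by rewrite expr2; apply: cvgM; apply: cvg_norm; exact: wc.
have sqZ k : continuous (fun x => `|u x + k *: v x| ^+ 2 : (R[i] : numFieldType)).
  by apply: sq => x; apply: cvgD; [exact: uc|apply: cvgZr; exact: vc].
have sqD : continuous (fun x => `|u x + v x| ^+ 2 : (R[i] : numFieldType)).
  by apply: sq => x; apply: cvgD; [exact: uc|exact: vc].
move=> x; apply: cvgM; first exact: cvg_cst.
apply: cvgD; first by apply: cvgB; [exact: sqD|exact: sqZ].
apply: cvgM; first exact: cvg_cst.
by apply: cvgB; exact: sqZ.
Qed.

End Hilbert.

(** A complex number [z] is nonnegative exactly when [`|z| = z], so the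
    assertion is that a continuous function vanishing on a dense set vanishes. *)
Lemma continuous_ge0_dense (R : realType) (T : topologicalType)
    (F : T -> (R[i] : numFieldType)) (S : set T) :
  continuous F -> dense S -> (forall x, S x -> 0 <= F x) -> forall x, 0 <= F x.
Proof.
move=> Fc Sd FS x.
pose Q y := `|F y| - F y.
have Qc : continuous Q.
  by move=> y; apply: cvgB; [apply: cvg_norm; exact: Fc|exact: Fc].
suff : Q x = 0.
  by move/eqP; rewrite subr_eq0 => /eqP <-; exact: normr_ge0.
apply: contrapT => Qx.
have oQ : open (Q @^-1` (~` [set 0])).
  apply: open_comp; first by move=> y _; exact: Qc.
  apply: closed_openC; apply: accessible_closed_set1.
  exact: hausdorff_accessible (@norm_hausdorff _ _).
have [|y [Qy Sy]] := Sd _ _ oQ; first by exists x.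
by apply: Qy; rewrite /Q /= ger0_norm ?subrr // FS.
Qed.

(** * The right module and its form *)

Section RightModule.
Variables (R : realType) (B : cstarAlgType R) (E : rightHilbertModType B).
Implicit Types (f g h : E) (a b : B).

Lemma ractDr f a b : ract f (a + b) = ract f a + ract f b.
Proof. by have := ract_linearr 1 f a b; rewrite !scale1r. Qed.

Lemma ract0r f : ract f (0 : B) = 0.
Proof. by apply: (addrI (ract f 0)); rewrite -ractDr !addr0. Qed.

Lemma ractZr (k : R[i]) f b : ract f (k *: b) = k *: ract f b.
Proof. by have := ract_linearr k f b 0; rewrite ract0r !addr0. Qed.

Lemma ractBr f a b : ract f (a - b) = ract f a - ract f b.
Proof. by rewrite -scaleN1r ractDr ractZr scaleN1r. Qed.

Lemma ripDr f g h : rip h (f + g) = rip h f + rip h g :> B.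
Proof. by have := rip_linear (s := E) 1 f g h; rewrite !scale1r. Qed.

Lemma rip0r h : rip h (0 : E) = 0 :> B.
Proof. by apply: (addrI (rip h 0)); rewrite -ripDr !addr0. Qed.

Lemma ripZr (k : R[i]) f h : rip h (k *: f) = k *: rip h f :> B.
Proof. by have := rip_linear (s := E) k f 0 h; rewrite rip0r !addr0. Qed.

Lemma ripBr f g h : rip h (f - g) = rip h f - rip h g :> B.
Proof. by rewrite -scaleN1r ripDr ripZr scaleN1r. Qed.

Lemma ripBl f g h : rip (f - g) h = rip f h - rip g h :> B.
Proof. by rewrite -rip_star ripBr starB !rip_star. Qed.

Lemma ripZlr (k : R) f h : rip (k%:C *: f) h = k%:C *: rip f h :> B.
Proof. by rewrite -rip_star ripZr starZr !rip_star. Qed.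

Lemma ripMl f g b : rip (ract f b) g = cmul (star b) (rip f g).
Proof. by rewrite -rip_star rip_act starM rip_star. Qed.

Lemma ract_unit (e : B) : (forall a : B, cmul e a = a /\ cmul a e = a) ->
  forall f, ract f e = f.
Proof.
move=> he f; apply/eqP; rewrite -subr_eq0; apply/eqP.
apply: (rip_eq0 (s := E)).
by rewrite ripBr rip_act (proj2 (he _)) subrr.
Qed.

End RightModule.

(** Since [<f, f'> y = <f, f' y> = 0], fullness gives a combination [s] of inner
    products with [s y = 0] at distance less than 1 from the unit; then
    [y = (1 - s) y] would have norm smaller than itself if it were not 0. *)
Lemma ract_faithful (R : realType) (A B : cstarAlgType R)
    (E : equivBimodType A B) (e : B) (y : B) :
  (forall a : B, cmul e a = a /\ cmul a e = a) ->
  (forall f : E, ract f y = 0) -> y = 0.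
Proof.
move=> he fy.
have [|s [es]] := @rip_full R A B E (ball e 1) _ (ball_open e 1).
  by exists e; exact: ballxx.
case=> n [c [v [vE sE]]].
have sy : cmul s y = 0.
  rewrite sE; elim/big_ind: _ => [|a b ya yb|i _].
  - exact: cmul0l.
  - by rewrite cmulDl ya yb addr0.
  - have [f [f' ->]] := vE i.
    by rewrite cmulZl -rip_act fy rip0r scaler0.
have es1 : rnorm (e - s) < 1.
  by move: es; rewrite -ball_normE /= rnormE ltcR.
have yE : y = cmul (e - s) y by rewrite cmulBl sy subr0 (proj1 (he y)).
apply: rnorm_eq0; have := rnormM (e - s) y; rewrite -yE.
by have := rnorm_ge0 y; nra.
Qed.

Section Gabor.
Variables (R : realType) (G : leftGaborBimodule R).
Implicit Types (f g h : G) (a b q : gaborB G).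

Lemma gdot_ge0 f : 0 <= gdot f f.
Proof. by case: (gabor_tr_faithful G) => _ + _; apply; exact: rip_ge0. Qed.

Lemma gdot_eq0 f : gdot f f = 0 -> f = 0.
Proof.
case: (gabor_tr_faithful G) => _ _ faith /faith f0.
by apply: (rip_eq0 (s := gaborE G)); apply: f0; exact: rip_ge0.
Qed.

Lemma gdot_ractE f b : gdot (gract f b) f = gabor_tr G (cmul (grip f f) b).
Proof. by rewrite /gdot /grip rip_act. Qed.

Lemma gdot_ractZ (k : R[i]) f b :
  gdot (gract f (k *: b)) f = k * gdot (gract f b) f.
Proof. by rewrite !gdot_ractE cmulZr linearZ. Qed.

Lemma gdot_ractD f a b :
  gdot (gract f (a + b)) f = gdot (gract f a) f + gdot (gract f b) f.
Proof. by rewrite !gdot_ractE cmulDr linearD. Qed.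

Lemma gdot_ractB f a b :
  gdot (gract f (a - b)) f = gdot (gract f a) f - gdot (gract f b) f.
Proof. by rewrite !gdot_ractE cmulBr linearB. Qed.

(** For [q = y* y], the trace property turns [tr (<f, f> y* y)] into
    [tr (<f y*, f y*>)]. *)
Lemma gdot_cpositive f q : cpositive q -> 0 <= gdot (gract f q) f.
Proof.
case=> y ->; rewrite gdot_ractE cmulA.
case: (gabor_tr_faithful G) => trC tr_ge0 _.
rewrite trC cmulA -[X in cmul (cmul X _)]starK /grip -ripMl -rip_act.
by apply: tr_ge0; exact: rip_ge0.
Qed.

(** For [b] of the form [<g, g>] these are the frame bounds, restricted to the
    dense subspace [E] of the completion. *)
Definition form_bounds b (C D : R) : Prop :=
  forall f, C%:C * gdot f f <= gdot (gract f b) f <= D%:C * gdot f f.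

Lemma frame_bounds_completion (H : gaborCompletion G) g (C D : R) :
  frame_bounds H g C D <-> form_bounds (grip g g) C D.
Proof.
split=> [fb f|fb].
  by have := fb (gc_incl H f); rewrite gc_act_incl !gc_incl_dot.
have idc : continuous (@id H) by move=> x; exact: cvg_id.
have ac := continuous_hdot (@gc_act_continuous R G H (grip g g)) idc.
have dc := continuous_hdot idc idc.
move=> x; rewrite -[X in X && _]subr_ge0 -[X in _ && X]subr_ge0.
have incl := @gc_incl_dense R G H.
apply/andP; split.
- apply: (continuous_ge0_dense (F := fun x => hdot (gc_act x (grip g g)) x
    - C%:C * hdot x x) _ incl) => [y|_ [f _ <-]].
    by apply: cvgB; [exact: ac|apply: cvgM; [exact: cvg_cst|exact: dc]].
  by rewrite gc_act_incl !gc_incl_dot subr_ge0; case/andP: (fb f).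
- apply: (continuous_ge0_dense (F := fun x => D%:C * hdot x x
    - hdot (gc_act x (grip g g)) x) _ incl) => [y|_ [f _ <-]].
    by apply: cvgB; [apply: cvgM; [exact: cvg_cst|exact: dc]|exact: ac].
  by rewrite gc_act_incl !gc_incl_dot subr_ge0; case/andP: (fb f).
Qed.

Lemma frame_opE g f : frame_op g f = gract f (grip g g).
Proof. exact: lip_rip. Qed.

(** * Dual generators and invertibility of the inner product *)

Variable e : gaborB G.
Hypothesis he : forall a, cmul e a = a /\ cmul a e = a.

Lemma dual_rip g h :
  (forall f, glact (glip f g) h = f) <-> grip g h = e.
Proof.
split=> [gh|gh f]; last first.
  by rewrite /glact /glip lip_rip -/(grip g h) gh ract_unit.
apply/eqP; rewrite -subr_eq0; apply/eqP.
apply: (ract_faithful (E := gaborE G) he) => f.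
have := gh f; rewrite /glact /glip lip_rip -/(grip g h) => ghf.
by rewrite ractBr (ract_unit he) ghf subrr.
Qed.

(** As [<g, h>] and [<h, g>] are both 1, the expansion of
    [<g - h/K, g - h/K>] is [b - 2/K + <h, h>/K^2]. With [<h, h> <= K] this
    gives [b >= 1/K]; the choice of the coefficient [1/K] maximizes the bound. *)
Lemma dual_form_bounds g h : grip g h = e ->
  exists C D : R, [/\ 0 < C, 0 < D & form_bounds (grip g g) C D].
Proof.
move=> gh.
have hg : grip h g = e by rewrite /grip -rip_star -/(grip g h) gh (star_unit he).
pose K := rnorm (grip h h) + 1; pose D := rnorm (grip g g) + 1.
have K0 : 0 < K by have := rnorm_ge0 (grip h h); rewrite /K; lra.
have D0 : 0 < D by have := rnorm_ge0 (grip g g); rewrite /D; lra.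
exists K^-1, D; split=> //; first by rewrite invr_gt0.
have rip_self k : star (grip k k) = grip k k by exact: rip_star.
have Kpos : cpositive (K%:C *: e - grip h h).
  by apply: cpositive_sub => //; rewrite /K; lra.
have Dpos : cpositive (D%:C *: e - grip g g).
  by apply: cpositive_sub => //; rewrite /D; lra.
have unit f : gdot (gract f e) f = gdot f f by rewrite /gract ract_unit.
move=> f; apply/andP; split; last first.
  by rewrite -subr_ge0 -unit -gdot_ractZ -gdot_ractB gdot_cpositive.
pose d := g - (K^-1)%:C *: h.
have dpos : cpositive (grip d d) by exact: rip_ge0.
have split_b : grip g g - (K^-1)%:C *: e =
    grip d d + (K^-1)%:C ^+ 2 *: (K%:C *: e - grip h h).
  rewrite /grip /d ripBl !ripBr !ripZlr !ripZr -/(grip g g) -/(grip g h).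
  rewrite -/(grip h g) -/(grip h h) gh hg !scalerBr !scalerA -expr2.
  have -> : (K^-1)%:C ^+ 2 * K%:C = (K^-1)%:C :> R[i].
    by rewrite expr2 -mulrA -rmorphM mulVf ?gt_eqF // rmorph1 mulr1.
  by rewrite opprB -addrA subrKA subrr addr0.
rewrite -subr_ge0 -unit -gdot_ractZ -gdot_ractB split_b gdot_ractD gdot_ractZ.
rewrite addr_ge0 ?gdot_cpositive // mulr_ge0 ?gdot_cpositive //.
by rewrite exprn_ge0 // lecR invr_ge0 ltW.
Qed.

(** A lower bound on the form of [b] makes [b] invertible as an operator on the
    completion of [E], but the inverse has to be found in [B]. The absolute
    value [w] of the shifted element [t] does lie in [B], and positivity of
    [w + t] as a form forces [w = t]. Half of [C] is kept for the strict
    positivity of [t], the other half, scaled to [c0], for inverting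
    [w + c0]. *)
Lemma form_bound_invertible b (C : R) :
  star b = b -> 0 < C ->
  (forall f, C%:C * gdot f f <= gdot (gract f b) f) ->
  exists c, cmul b c = e /\ cmul c b = e.
Proof.
move=> bs C0 fb.
pose M := rnorm (b - (C / 2)%:C *: e) + 1.
have M0 : 0 < M by rewrite /M; have := rnorm_ge0 (b - (C / 2)%:C *: e); lra.
pose t := (M^-1)%:C *: (b - (C / 2)%:C *: e).
have ts : star t = t by rewrite starZr starB starZr (star_unit he) bs.
have t1 : rnorm t <= 1.
  rewrite rnormZ ger0_norm ?invr_ge0 ?(ltW M0) //.
  by rewrite mulrC ler_pdivrMr // mul1r /M; lra.
have [w [ws w2 wt w1]] := cstar_abs he ts t1.
have unit f : gdot (gract f e) f = gdot f f by rewrite /gract ract_unit.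
pose c0 : R := C / 2 / M.
have c00 : 0 < c0 by rewrite !divr_gt0.
have wpos : cpositive w.
  have := @cpositive_sub _ _ _ he (e - w) 1.
  by rewrite rmorph1 scale1r subKr; apply=> //; rewrite starB (star_unit he) ws.
have t_ge f : c0%:C * gdot f f <= gdot (gract f t) f.
  rewrite gdot_ractZ gdot_ractB gdot_ractZ unit /c0 mulrC [C / 2 / M]mulrC.
  rewrite mulrC rmorphM -mulrA ler_wpM2l ?lecR ?invr_ge0 ?(ltW M0) //.
  rewrite lerBrDr -mulrDl -rmorphD -splitr.
  exact: fb.
have wE : w = t.
  apply/eqP; rewrite -subr_eq0; apply/eqP.
  apply: (ract_faithful (E := gaborE G) he) => f.
  pose k : G := gract f (w - t).
  have kwt : gract k (w + t) = 0.
    rewrite /k /gract -ractM cmulBl !cmulDr w2 wt.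
    by rewrite [X in _ - X]addrC subrr ract0r.
  apply: (gdot_eq0 (f := k)); apply/eqP.
  have : gdot (gract k (w + t)) k = 0 by rewrite kwt /gdot /grip rip0r linear0.
  rewrite gdot_ractD => kk.
  have c0C : 0 < c0%:C :> R[i] by rewrite ltcR.
  rewrite eq_le gdot_ge0 andbT -(pmulr_rle0 _ c0C) -kk.
  by apply: le_trans (t_ge k) _; rewrite lerDr gdot_cpositive.
pose m : R := 1 + c0.
have m0 : 0 < m by rewrite addr_gt0.
have [|c [xc cx]] := @invertible_near_unit _ _ _ he ((m^-1)%:C *: (e - w)).
  rewrite rnormZ ger0_norm ?invr_ge0 ?(ltW m0) //.
  by rewrite mulrC ltr_pdivrMr // mul1r /m; lra.
have bE : b = (M * m)%:C *: (e - (m^-1)%:C *: (e - w)).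
  rewrite scalerBr scalerA -rmorphM mulfK ?gt_eqF // scalerBr wE /t scalerA.
  rewrite -rmorphM mulfV ?gt_eqF // rmorph1 scale1r.
  have -> : M * m = C / 2 + M by rewrite /m /c0; field; rewrite gt_eqF.
  by rewrite rmorphD /= scalerDl opprB -[b - _ - _]addrA -opprD [RHS]addrC subrK.
exists ((M * m)^-1%:C *: c).
have Mm : (M * m)^-1 * (M * m) = 1 by rewrite mulVf // gt_eqF // mulr_gt0.
rewrite bE !cmulZl !cmulZr xc cx !scalerA -!rmorphM [M * m * _]mulrC Mm.
by rewrite rmorph1 scale1r.
Qed.

End Gabor.

(** * The frame criterion *)

Theorem proposition3p30 (R : realType) (G : leftGaborBimodule R)
    (H : gaborCompletion G) (g : G) :
  ((exists h : G, forall f : G, glact (glip f g) h = f)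
    <-> (exists C D : R, [/\ 0 < C, 0 < D & frame_bounds H g C D]))
  /\
  (generates_module_frame g
    <-> (exists C D : R, [/\ 0 < C, 0 < D & frame_bounds H g C D])).
Proof.
have [e he] := gaborB_unital G.
have dual_bounds : (exists h : G, forall f : G, glact (glip f g) h = f) ->
    exists C D : R, [/\ 0 < C, 0 < D & frame_bounds H g C D].
  case=> h /(dual_rip he) /(dual_form_bounds he)[C [D [C0 D0 fb]]].
  by exists C, D; split=> //; apply/frame_bounds_completion.
have bounds_inv : (exists C D : R, [/\ 0 < C, 0 < D & frame_bounds H g C D]) ->
    exists c, cmul (grip g g) c = e /\ cmul c (grip g g) = e.
  case=> C [D [C0 _ /frame_bounds_completion fb]].
  apply: (form_bound_invertible he _ C0) => [|f]; first exact: rip_star.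
  by case/andP: (fb f).
split; split=> //.
- move=> /bounds_inv[c [bc _]]; exists (gract g c); apply/(dual_rip he).
  by rewrite /grip /gract rip_act.
(* [Theta (<f, g> T g) = <f, g> Theta (T g) = <f, g> g = Theta f]. *)
- case=> T frameK TK; apply: dual_bounds; exists (T g) => f.
  apply: (can_inj frameK).
  rewrite /frame_op /glact /glip lip_act lactM -/(glip (T g) g).
  by rewrite -/(glact _ g) -/(frame_op g (T g)) TK.
- move=> /bounds_inv[c [bc cb]].
  exists (fun f => gract f c) => f; rewrite frame_opE /gract -ractM ?bc ?cb;
    exact: ract_unit.
Qed.
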